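(* Let $k \geq 1$ and let $G$ and $H$ be finite simple graphs with $\delta(H) \geq k$. Then $$\rho(G)\, \gamma_{\times k,t}(H) \leq \gamma_{\times k,t}(G\Box H).$$ Consequently, if in addition $\delta(G) \geq k$ and $\gamma_{\times k,t}(G) \leq 2k\rho(G)$, then $$\gamma_{\times k,t}(G)\, \gamma_{\times k,t}(H) \leq 2k\, \gamma_{\times k,t}(G\Box H).$$
   Context: All graphs are finite, undirected and simple; $N_G(v)$ is the open neighborhood, $N_G[v]=N_G(v)\cup\{v\}$ the closed neighborhood, and $\delta(G)$ the minimum degree. For $k\geq 1$, a set $S\subseteq V(G)$ is a $k$-tuple total dominating set if every vertex $v\in V(G)$ satisfies $|N_G(v)\cap S|\geq k$; such a set exists iff $\delta(G)\geq k$, and then $\gamma_{\times k,t}(G)$ denotes the minimum cardinality of such a set. A packing of $G$ is a set of vertices whose closed neighborhoods are pairwise disjoint; $\rho(G)$ is the maximum cardinality of a packing. The Cartesian product $G\Box H$ has vertex set $V(G)\times V(H)$, with $(u_1,v_1)$ adjacent to $(u_2,v_2)$ iff either $u_1=u_2$ and $v_1v_2\in E(H)$, or $v_1=v_2$ and $u_1u_2\in E(G)$. *)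

(* Defs.v *)
From mathcomp Require Import all_boot.

Set Implicit Arguments.
Unset Strict Implicit.
Unset Printing Implicit Defensive.

Record sgraph := SGraph {
  vertex :> finType;
  adj : rel vertex;
  adj_sym : symmetric adj;
  adj_irrefl : irreflexive adj }.

Section GraphInvariants.
Variable G : sgraph.

Definition open_nbh (v : G) : {set G} := [set u | adj v u].

Definition closed_nbh (v : G) : {set G} := v |: open_nbh v.

(* Every degree is < #|G|, so the default value of the minimum is never
   attained when G has a vertex; the null graph gets minimum degree 0. *)
Definition min_degree : nat := \big[minn/#|G|]_(v : G) #|open_nbh v|.

Definition ktuple_total_dominating (k : nat) (S : {set G}) : bool :=
  [forall v : G, k <= #|open_nbh v :&: S|].

(* The default #|G| bounds every #|S|, so this is the true minimum as soon as
   some k-tuple total dominating set exists; otherwise it is a junk value. *)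
Definition gamma_kt (k : nat) : nat :=
  \big[minn/#|G|]_(S : {set G} | ktuple_total_dominating k S) #|S|.

Definition packing (P : {set G}) : bool :=
  [forall u in P, forall v in P,
     (u != v) ==> [disjoint closed_nbh u & closed_nbh v]].

Definition packing_number : nat := \max_(P : {set G} | packing P) #|P|.

End GraphInvariants.

Section CartesianProduct.
Variables G H : sgraph.

Definition cart_adj : rel (G * H) := fun x y =>
  ((x.1 == y.1) && adj x.2 y.2) || ((x.2 == y.2) && adj x.1 y.1).

Lemma cart_adj_sym : symmetric cart_adj.
Proof.
by move=> x y; rewrite /cart_adj ![_ == y.1]eq_sym ![_ == y.2]eq_sym
  (adj_sym x.1) (adj_sym x.2).
Qed.

Lemma cart_adj_irrefl : irreflexive cart_adj.
Proof. by move=> x; rewrite /cart_adj !adj_irrefl !andbF. Qed.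

Definition cart_prod : sgraph := SGraph cart_adj_sym cart_adj_irrefl.

End CartesianProduct.

(* Main.v *)
(* Let D be k-tuple total dominating in G [] H and u a vertex of a maximum
   packing P of G.  Start from the part of D lying over u, seen inside H.  A
   vertex v of H that lacks some of its k neighbours there has at least as many
   D-neighbours (w, v) with w in N(u), so it can be given the missing neighbours
   from N(v), which is possible since delta(H) >= k, at that cost.  Hence
   gamma(H) is at most the size of the part of D lying over N[u].  The sets
   N[u], u in P, are disjoint, and summing over u gives the bound. *)
Require Import Defs.
From mathcomp Require Import all_boot all_order.

(* On nat, minn and Order.min are convertible but not syntactically equal, so
   the type must be given to use the bigmin lemmas. *)
Lemma gamma_kt_le (G : sgraph) (k : nat) (S : {set G}) :
  ktuple_total_dominating k S -> gamma_kt G k <= #|S|.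
Proof. by move=> domS; exact: (@Order.TotalTheory.bigmin_le_cond _ nat). Qed.

Lemma min_degree_le (G : sgraph) (v : G) : min_degree G <= #|open_nbh v|.
Proof. exact: (@Order.TotalTheory.bigmin_le _ nat). Qed.

(** The [n]-subsets of [A] are counted by a binomial coefficient, positive since [n <= #|A|]. *)
Lemma subset_of_card (T : finType) (A : {set T}) (n : nat) :
  n <= #|A| -> exists2 B : {set T}, B \subset A & #|B| = n.
Proof.
rewrite -bin_gt0 -cards_draws card_gt0 => /set0Pn[B].
by rewrite inE => /andP[sBA /eqP cardB]; exists B.
Qed.

Lemma gamma_kt_le_deficit (H : sgraph) (k : nat) (A : {set H}) (f : H -> nat) :
    k <= min_degree H ->
    (forall v, k <= #|open_nbh v :&: A| + f v) ->
  gamma_kt H k <= #|A| + \sum_v f v.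
Proof.
move=> deltaH deficit.
(* [B v] repairs the deficit of [v] exactly; by truncated subtraction it is empty when [v] has
   none. *)
have /fin_all_exists2[B sBN cardB] v :
    exists2 B : {set H}, B \subset open_nbh v :\: A
                       & #|B| = k - #|open_nbh v :&: A|.
  apply: subset_of_card; rewrite cardsD leq_sub2r //.
  exact: leq_trans deltaH (min_degree_le _ _).
have domS : ktuple_total_dominating k (A :|: \bigcup_v B v).
  apply/forallP => v; have /subsetDP[sBv disjBA] := sBN v.
  apply: (@leq_trans #|(open_nbh v :&: A) :|: B v|); last first.
    apply: subset_leq_card; rewrite subUset setIS ?subsetUl //.
    by rewrite subsetI sBv subsetU // bigcup_sup ?orbT.
  have disj : [disjoint open_nbh v :&: A & B v].
    by apply: (disjointWl (subsetIr _ _)); rewrite disjoint_sym.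
  by rewrite cardsU (disjoint_setI0 disj) cards0 subn0 cardB -leq_subLR.
apply: leq_trans (gamma_kt_le _ _ _ domS) _.
apply: leq_trans (leq_card_setU _ _) _; rewrite leq_add2l.
apply: (@leq_trans (\sum_v #|B v|)).
  elim/big_rec2: _ => [|v m S _ leSm]; first by rewrite cards0.
  by apply: leq_trans (leq_card_setU _ _) _; rewrite leq_add2l.
by apply: leq_sum => v _; rewrite cardB leq_subLR.
Qed.

Definition fiber {G H : finType} (D : {set G * H}) (u : G) : {set H} :=
  [set v | (u, v) \in D].

Lemma sum_card_fiber {G H : finType} (D : {set G * H}) :
  \sum_u #|fiber D u| = #|D|.
Proof.
rewrite -sum1_card (eq_bigr (fun u => \sum_(v | (u, v) \in D) 1)).
  by rewrite pair_big_dep; apply: eq_bigl => -[u v].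
by move=> u _; rewrite -sum1_card; apply: eq_bigl => v; rewrite inE.
Qed.

Lemma gamma_kt_le_closed_nbh (G H : sgraph) (k : nat)
    (D : {set cart_prod G H}) (u : G) :
    k <= min_degree H -> ktuple_total_dominating k D ->
  gamma_kt H k <= \sum_(w in closed_nbh u) #|fiber D w|.
Proof.
move=> deltaH /forallP domD.
rewrite big_setU1 ?inE ?adj_irrefl //=.
(* Double counting: grouped by [v], the pairs of [D] over neighbours of [u] give the deficit bound
   [f v]. *)
have -> : \sum_(w in open_nbh u) #|fiber D w|
        = \sum_v #|[set w in open_nbh u | (w, v) \in D]|.
  under eq_bigr do rewrite -sum1_card; under [RHS]eq_bigr do rewrite -sum1_card.
  rewrite (exchange_big_dep predT) //=; apply: eq_bigr => v _.
  by apply: eq_bigl => w; rewrite !inE.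
apply: gamma_kt_le_deficit => // v.
apply: leq_trans (domD (u, v)) _.
set X := open_nbh v :&: _; set Y := [set w in _ | _].
(* A neighbour of [(u, v)] keeps either the first coordinate (set [X]) or the second (set [Y]). *)
apply: (@leq_trans #|[set (u, y) | y in X] :|: [set (w, v) | w in Y]|).
  apply/subset_leq_card/subsetP => -[w y]; rewrite !inE /= /cart_adj /=.
  case/andP => /orP[] /andP[/eqP<- adj_] Dwy; apply/orP; [left|right].
    by apply/imsetP; exists y; rewrite ?inE ?adj_.
  by apply/imsetP; exists w; rewrite ?inE ?adj_.
apply: leq_trans (leq_card_setU _ _) _.
by apply: leq_add; apply: leq_imset_card.
Qed.

(** After exchanging the sums, [f w] is counted once per [u] in [P] with [w] in [closed_nbh u];
    disjointness allows at most one such [u]. *)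
Lemma packing_sum_le (G : sgraph) (P : {set G}) (f : G -> nat) :
  packing P -> \sum_(u in P) \sum_(w in closed_nbh u) f w <= \sum_w f w.
Proof.
move=> /forall_inP packP.
rewrite (exchange_big_dep predT) //=; apply: leq_sum => w _.
rewrite sum_nat_const -[leqRHS]mul1n leq_mul2r; apply/orP; right.
apply/card_le1_eqP => v u /andP[Pv vw] /andP[Pu uw].
apply/eqP; apply: contraLR uw => neq_uv.
have /forall_inP/(_ _ Pv) := packP _ Pu; rewrite neq_uv /= => disj.
by rewrite (disjointFl disj vw).
Qed.

Theorem theorem1 (k : nat) (G H : sgraph) (k_ge1 : 1 <= k)
    (delta_H : k <= min_degree H) :
  packing_number G * gamma_kt H k <= gamma_kt (cart_prod G H) k
  /\ (k <= min_degree G ->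
      gamma_kt G k <= 2 * k * packing_number G ->
      gamma_kt G k * gamma_kt H k <= 2 * k * gamma_kt (cart_prod G H) k).
Proof.
have bound (D : {set cart_prod G H}) : ktuple_total_dominating k D ->
    packing_number G * gamma_kt H k <= #|D|.
  move=> domD; rewrite /packing_number.
  (* The maximum is attained because the empty set is a packing. *)
  have [|P packP ->] := @eq_bigmax_cond _ (@packing G) (fun P => #|P|).
    by apply/card_gt0P; exists set0; apply/forall_inP => u; rewrite inE.
  rewrite -sum_nat_const -sum_card_fiber.
  apply: leq_trans (packing_sum_le _ _ _ packP).
  by apply: leq_sum => u _; apply: gamma_kt_le_closed_nbh.
have main : packing_number G * gamma_kt H k <= gamma_kt (cart_prod G H) k.
  apply: (@Order.POrderTheory.le_bigmin _ nat) => [|D]; last exact: bound.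
  (* The default value of the minimum must satisfy the bound too: it is the size of the full vertex
     set, which dominates since [(u, v)] has at least the degree of [v]. *)
  rewrite -cardsT; apply/bound/forallP => -[u v]; rewrite setIT.
  apply: leq_trans delta_H (leq_trans (min_degree_le _ v) _).
  rewrite -(card_imset _ (_ : injective (pair u))); last by move=> ? ? [].
  apply/subset_leq_card/subsetP => _ /imsetP[y adj_vy ->].
  by move: adj_vy; rewrite !inE /= /cart_adj /= eqxx => ->.
split=> // _ gammaG.
apply: (@leq_trans (2 * k * packing_number G * gamma_kt H k)).
  by rewrite leq_mul2r gammaG orbT.
by rewrite -mulnA leq_mul2l main orbT.
Qed.
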